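(* Let $d=2d_0$ where $d_0$ is a positive even integer. Let $f\in\mathbb{Q}(x)$ and $\alpha\in R^{\pm}=\mathbb{Z}[\{\pm1\}\times\mathbb{Z}^{\mathrm{odd}}]$. Suppose there exists $\beta\in\operatorname{Ann}_{R^{\pm}}(f)$ such that $\theta_d(\alpha)=\theta_d(\beta)$ and $f$ is defined at $\zeta_d^{(\epsilon,m)}$ for each $(\epsilon,m)\in\operatorname{Supp}(\alpha)\cup\operatorname{Supp}(\beta)$. Then $\Phi_d$ is a factor of $\alpha f$.
   Context: $\mathbb{Z}^{\mathrm{odd}}$ is the multiplicative monoid of all odd integers and $R^{\pm}=\mathbb{Z}[\{\pm1\}\times\mathbb{Z}^{\mathrm{odd}}]$ is the integral monoid ring of the product monoid (the signed Mahler algebra). It acts on $\mathbb{Q}(x)$ by linear extension of $([(\epsilon,m)]f)(x)=f(\epsilon x^m)$, and $\operatorname{Ann}_{R^{\pm}}(f)=\{r\in R^{\pm}: rf=0\}$. The support of $\alpha=\sum a_{\epsilon,m}[(\epsilon,m)]$ is $\operatorname{Supp}(\alpha)=\{(\epsilon,m): a_{\epsilon,m}\ne0\}$. $(\mathbb{Z}/d)^\circ$ is the multiplicative monoid of all residue classes mod $d$ (including $0$). For $d=2d_0$ with $d_0$ even, $\theta_d:R^{\pm}\to\mathbb{Z}[(\mathbb{Z}/d)^\circ]$ is the ring homomorphism induced by the monoid homomorphism $(1,m)\mapsto\overline{m}$, $(-1,m)\mapsto\overline{d_0+m}$. For $\xi\in\mathbb{C}$ put $\xi^{(\epsilon,m)}=\epsilon\xi^m$.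 $\zeta_d$ is a primitive $d$-th root of unity in $\mathbb{C}$ and $\Phi_d$ is the $d$-th cyclotomic polynomial. $F\in\mathbb{Q}(x)$ is defined at $\xi\in\mathbb{C}$ if $\xi$ is not a pole of $F$. $\Phi_d$ is a factor of $F$ if $F=P/Q$ with $P,Q\in\mathbb{Q}[x]$, $\Phi_d\mid P$, $\Phi_d\nmid Q$; equivalently, $F$ is defined at $\zeta_d$ and $F(\zeta_d)=0$. *)

(* Defs.v *)
From HB Require Import structures.
From mathcomp Require Import all_boot all_order all_algebra all_field.
From mathcomp Require Import finmap monalg.

Set Implicit Arguments.
Unset Strict Implicit.
Unset Printing Implicit Defensive.

Import GRing.Theory Num.Theory.

Local Open Scope fset_scope.
Local Open Scope ring_scope.

(* The integral monoid ring Z[M]. The additive group is that of [monalg]; the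
   ring structure of [monalg] is not available here, because its [monomType]
   requires that x * y = 1 only for x = y = 1, which fails for {1, -1}. *)
Definition mring (M : monoidType) : Type := {malg int[M]}.

Section MonoidRing.
Variable M : monoidType.

HB.instance Definition _ := GRing.Zmodule.on (mring M).

Implicit Types (g : mring M) (k : M).

Definition mrone : mring M := << 1%g >>.

Definition mrmul g1 g2 : mring M :=
  \sum_(k1 <- msupp g1) \sum_(k2 <- msupp g2)
    << g1@_k1 * g2@_k2 *g (k1 * k2)%g >>.

Lemma mrmulw (d1 d2 : {fset M}) g1 g2 :
  msupp g1 `<=` d1 -> msupp g2 `<=` d2 ->
  mrmul g1 g2 = \sum_(k1 <- d1) \sum_(k2 <- d2)
    << g1@_k1 * g2@_k2 *g (k1 * k2)%g >>.
Proof.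
move=> le_d1 le_d2; rewrite /mrmul (big_fset_incl _ le_d1) /=.
  apply/eq_bigr=> k1 _; apply/big_fset_incl => // k _ /mcoeff_outdom ->.
  by rewrite mulr0 monalgU0.
move=> k _ /mcoeff_outdom g1k.
by rewrite big1 => // k' _; rewrite g1k mul0r monalgU0.
Qed.

Lemma mrmulUU c1 c2 k1 k2 :
  mrmul << c1 *g k1 >> << c2 *g k2 >> = << c1 * c2 *g (k1 * k2)%g >>.
Proof. by rewrite (mrmulw msuppU_le msuppU_le) !big_seq_fset1 !mcoeffUU. Qed.

Lemma mrmulDl : left_distributive mrmul +%R.
Proof.
move=> g1 g2 g; rewrite (mrmulw (msuppD_le _ _) (fsubset_refl _)).
rewrite (mrmulw (fsubsetUl _ (msupp g2)) (fsubset_refl _)).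
rewrite (mrmulw (fsubsetUr (msupp g1) _) (fsubset_refl _)).
rewrite -big_split /=; apply/eq_bigr=> k1 _.
rewrite -big_split /=; apply/eq_bigr=> k2 _.
by rewrite mcoeffD mulrDl monalgUD.
Qed.

Lemma mrmulDr : right_distributive mrmul +%R.
Proof.
move=> g g1 g2; rewrite (mrmulw (fsubset_refl _) (msuppD_le _ _)).
rewrite (mrmulw (fsubset_refl _) (fsubsetUl _ (msupp g2))).
rewrite (mrmulw (fsubset_refl _) (fsubsetUr (msupp g1) _)).
rewrite -big_split /=; apply/eq_bigr=> k1 _.
rewrite -big_split /=; apply/eq_bigr=> k2 _.
by rewrite mcoeffD mulrDr monalgUD.
Qed.

Lemma mrmul0g : left_zero 0 mrmul.
Proof. by move=> g; rewrite /mrmul msupp0 big_seq_fset0. Qed.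

Lemma mrmulg0 : right_zero 0 mrmul.
Proof. by move=> g; rewrite /mrmul big1 // => k _; rewrite msupp0 big_seq_fset0. Qed.

Lemma mrmul_suml (I : Type) (s : seq I) (F : I -> mring M) g :
  mrmul (\sum_(i <- s) F i) g = \sum_(i <- s) mrmul (F i) g.
Proof. exact: (big_morph (mrmul^~ g) (fun _ _ => mrmulDl _ _ _) (mrmul0g g)). Qed.

Lemma mrmul_sumr (I : Type) (s : seq I) (F : I -> mring M) g :
  mrmul g (\sum_(i <- s) F i) = \sum_(i <- s) mrmul g (F i).
Proof. exact: (big_morph (mrmul g) (fun _ _ => mrmulDr _ _ _) (mrmulg0 g)). Qed.

Lemma mringE g : g = \sum_(k <- msupp g) (<< g@_k *g k >> : mring M).
Proof. exact: (@monalgE M int g). Qed.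

Lemma mrmul1g : left_id mrone mrmul.
Proof.
move=> g; rewrite {1}[g]mringE mrmul_sumr [RHS]mringE.
by apply: eq_bigr => k _; rewrite mrmulUU mul1r mul1g.
Qed.

Lemma mrmulg1 : right_id mrone mrmul.
Proof.
move=> g; rewrite {1}[g]mringE mrmul_suml [RHS]mringE.
by apply: eq_bigr => k _; rewrite mrmulUU mulr1 mulg1.
Qed.

Lemma mrmulA : associative mrmul.
Proof.
move=> g1 g2 g3; rewrite [g1]mringE !mrmul_suml; apply: eq_bigr => k1 _.
rewrite [g2]mringE mrmul_suml !mrmul_sumr mrmul_suml; apply: eq_bigr => k2 _.
rewrite [g3]mringE !mrmul_sumr; apply: eq_bigr => k3 _.
by rewrite !mrmulUU mulrA mulgA.
Qed.

Lemma mrone_neq0 : mrone != 0.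
Proof. by rewrite /mrone monalgU_eq0 oner_eq0. Qed.

HB.instance Definition _ := GRing.Zmodule_isNzRing.Build (mring M)
  mrmulA mrmul1g mrmulg1 mrmulDl mrmulDr mrone_neq0.

End MonoidRing.

Lemma mringM (M : monoidType) (g1 g2 : mring M) :
  g1 * g2 = \sum_(k1 <- msupp g1) \sum_(k2 <- msupp g2)
    (<< g1@_k1 * g2@_k2 *g (k1 * k2)%g >> : mring M).
Proof. by []. Qed.

Lemma mringUM (M : monoidType) c1 c2 (k1 k2 : M) :
  (<< c1 *g k1 >> : mring M) * << c2 *g k2 >> = << c1 * c2 *g (k1 * k2)%g >>.
Proof. exact: mrmulUU. Qed.

Definition mring_map (M N : monoidType) (h : M -> N) (g : mring M) : mring N :=
  mmap intr (fun k : M => << h k >> : mring N) g.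

Lemma mring_mapU (M N : monoidType) (h : M -> N) c k :
  mring_map h << c *g k >> = c%:~R * (<< h k >> : mring N).
Proof. exact: mmapU. Qed.

Lemma intmul_mulACA (R : nzRingType) (a b : int) (x y : R) :
  a%:~R * b%:~R * (x * y) = a%:~R * x * (b%:~R * y).
Proof. by rewrite -!mulrA; congr (_ * _); rewrite !mulrA mulrzl mulrzr. Qed.

Lemma mring_map_monoid_morphism (M N : monoidType) (h : M -> N) :
  monoid.monoid_morphism h -> GRing.monoid_morphism (mring_map h).
Proof.
case=> h1 hM; split=> [|g1 g2]; first by rewrite [LHS]mring_mapU mul1r h1.
rewrite mringM /mring_map raddf_sum [mmap _ _ g1]mmapE mulr_suml.
apply: eq_bigr => k1 _; rewrite raddf_sum [mmap _ _ g2]mmapE mulr_sumr.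
apply: eq_bigr => k2 _; rewrite [LHS]mring_mapU hM intrM.
have -> : (<< (h k1 * h k2)%g >> : mring N)
    = (<< h k1 >> : mring N) * << h k2 >> by rewrite mringUM mulr1.
exact: intmul_mulACA.
Qed.

(* The multiplicative monoid of a ring, as a type of its own: several ring
   types already carry the [monoidType] structure of their additive group. *)
Definition mulmonoid (R : nzRingType) : Type := R.

HB.instance Definition _ (R : nzRingType) := Choice.on (mulmonoid R).
HB.instance Definition _ (R : nzRingType) := isMonoid.Build (mulmonoid R)
  (@mulrA R) (@mul1r R) (@mulr1 R).

Definition is_sign (e : int) := (e == 1) || (e == -1).
Definition is_odd (m : int) := odd `|m|%N.

Definition signs : Type := {e : int | is_sign e}.
Definition zodd : Type := {m : int | is_odd m}.

HB.instance Definition _ := Choice.on signs.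
HB.instance Definition _ := Choice.on zodd.

Fact is_sign1 : is_sign 1. Proof. by []. Qed.
Fact is_signM (e1 e2 : signs) : is_sign (val e1 * val e2).
Proof. by case: e1 e2 => ? /= /orP[]/eqP-> [? /= /orP[]/eqP->]. Qed.
Fact is_odd1 : is_odd 1. Proof. by []. Qed.
Fact is_oddM (m1 m2 : zodd) : is_odd (val m1 * val m2).
Proof.
by case: m1 m2 => m1 o1 [m2 o2]; rewrite /is_odd /= abszM oddM; apply/andP.
Qed.

Definition signs_one : signs := Sub 1 is_sign1.
Definition signs_mul (e1 e2 : signs) : signs := Sub _ (is_signM e1 e2).
Definition zodd_one : zodd := Sub 1 is_odd1.
Definition zodd_mul (m1 m2 : zodd) : zodd := Sub _ (is_oddM m1 m2).

Fact signs_mulA : associative signs_mul.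
Proof. by move=> x y z; apply/val_inj/mulrA. Qed.
Fact signs_mul1 : left_id signs_one signs_mul.
Proof. by move=> x; apply/val_inj/mul1r. Qed.
Fact signs_1mul : right_id signs_one signs_mul.
Proof. by move=> x; apply/val_inj/mulr1. Qed.
HB.instance Definition _ :=
  isMonoid.Build signs signs_mulA signs_mul1 signs_1mul.

Fact zodd_mulA : associative zodd_mul.
Proof. by move=> x y z; apply/val_inj/mulrA. Qed.
Fact zodd_mul1 : left_id zodd_one zodd_mul.
Proof. by move=> x; apply/val_inj/mul1r. Qed.
Fact zodd_1mul : right_id zodd_one zodd_mul.
Proof. by move=> x; apply/val_inj/mulr1. Qed.
HB.instance Definition _ := isMonoid.Build zodd zodd_mulA zodd_mul1 zodd_1mul.

Definition signed_odd : Type := (signs * zodd)%type.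

HB.instance Definition _ := Choice.on signed_odd.

Definition signed_odd_mul (k l : signed_odd) : signed_odd :=
  ((k.1 * l.1)%g, (k.2 * l.2)%g).

Fact signed_odd_mulA : associative signed_odd_mul.
Proof. by move=> x y z; rewrite /signed_odd_mul !mulgA. Qed.
Fact signed_odd_mul1 : left_id (1%g, 1%g) signed_odd_mul.
Proof. by case=> e m; rewrite /signed_odd_mul !mul1g. Qed.
Fact signed_odd_1mul : right_id (1%g, 1%g) signed_odd_mul.
Proof. by case=> e m; rewrite /signed_odd_mul !mulg1. Qed.
HB.instance Definition _ :=
  isMonoid.Build signed_odd signed_odd_mulA signed_odd_mul1 signed_odd_1mul.

Notation Rpm := (mring signed_odd).

(* x^(e,m) = e x^m; the exponent m may be negative. *)
Definition spow (K : unitRingType) (x : K) (k : signed_odd) : K :=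
  (val k.1)%:~R * x ^ val k.2.

Lemma spowP (K : unitRingType) (x : K) k : exists2 n, (0 < n)%N &
  (spow x k = x ^+ n \/ spow x k = - x ^+ n) \/
  (spow x k = x ^- n \/ spow x k = - x ^- n).
Proof.
rewrite /spow; case: k => -[e /= /orP[]/eqP->] [[[//|n]|n] /= _];
  exists n.+1 => //; rewrite ?mul1r ?mulrN1z ?mulN1r;
  by [left; left | left; right | right; left | right; right].
Qed.

Notation Qx := {fraction {poly rat}}.

Notation "P %:F" := (@FracField.tofrac {poly rat} P) : ring_scope.

(* f(g) for f, g in Q(x), computed on a chosen numerator and denominator of f.
   The value does not depend on that choice when g is not constant: see
   [fcomp_frac] and [sact1_frac] below. *)
Definition peval (P : {poly rat}) (g : Qx) : Qx :=
  (map_poly (@FracField.tofrac {poly rat} \o polyC) P).[g].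
Definition fcomp (f g : Qx) : Qx :=
  peval (\n_(repr f)) g / peval (\d_(repr f)) g.

Definition sact1 (k : signed_odd) (f : Qx) : Qx := fcomp f (spow 'X%:F k).

Definition sact (r : Rpm) (f : Qx) : Qx := mmap intr (fun k => sact1 k f) r.

Definition Ann (f : Qx) : {pred Rpm} := [pred r | sact r f == 0].

Lemma pevalM (P Q : {poly rat}) (g : Qx) :
  peval (P * Q) g = peval P g * peval Q g.
Proof. by rewrite /peval rmorphM hornerM. Qed.

Lemma fcomp_frac (P Q : {poly rat}) (g : Qx) :
    (forall S : {poly rat}, S != 0 -> peval S g != 0) -> Q != 0 ->
  fcomp (P%:F / Q%:F) g = peval P g / peval Q g.
Proof.
move=> gT nzQ; rewrite /fcomp; set x := P%:F / Q%:F.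
have nzd : \d_(repr x) != 0 by apply: denom_ratioP.
have xE : x = (\n_(repr x))%:F / (\d_(repr x))%:F.
  rewrite -[LHS]reprK; apply: (mulIf (x := (\d_(repr x))%:F)).
    by rewrite tofrac_eq0.
  rewrite divfK ?tofrac_eq0 //; move: (repr x) nzd => r nzd; unlock FracField.tofrac.
  rewrite -[LHS]FracField.pi_mul; apply/eqmodP.
  rewrite /= FracField.equivfE /FracField.mulf.
  by rewrite !numden_Ratio ?mulr1 ?oner_neq0 // mulrC.
apply/eqP; rewrite eqr_div ?gT // -!pevalM.
have /eqP := xE; rewrite {1}/x eqr_div ?tofrac_eq0 // -!tofracM tofrac_eq.
by move=> /eqP->; rewrite mulrC.
Qed.

Lemma peval_spow_neq0 k (P : {poly rat}) :
  P != 0 -> peval P (spow 'X%:F k) != 0.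
Proof.
pose alg := algebraicOver (@FracField.tofrac {poly rat} \o polyC).
have tr n : (0 < n)%N -> ~ alg ('X%:F ^+ n).
  move=> n_gt0 [p nz_p]; rewrite -tofracXn /root map_poly_comp.
  rewrite horner_map tofrac_eq0 -/(comp_poly 'X^n p) comp_poly_eq0.
    exact/negP.
  by rewrite size_polyXn ltnS.
move=> nzP; apply/eqP => P0; have : alg (spow 'X%:F k) by exists P; last exact/eqP.
have [n n_gt0 [|]] := spowP 'X%:F k; case=> ->; first exact: tr.
- by move/algebraic_opp; rewrite opprK; apply: tr.
- by move/algebraic_inv; rewrite invrK; apply: tr.
by move/algebraic_opp; rewrite opprK => /algebraic_inv; rewrite invrK; apply: tr.
Qed.

Lemma sact1_frac k (P Q : {poly rat}) : Q != 0 ->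
  sact1 k (P%:F / Q%:F)
  = peval P (spow 'X%:F k) / peval Q (spow 'X%:F k).
Proof. by apply: fcomp_frac => S; apply: peval_spow_neq0. Qed.

Definition theta_mon (d0 : nat) (k : signed_odd) : mulmonoid 'Z_(2 * d0) :=
  if val k.1 == 1 then (val k.2)%:~R else d0%:R + (val k.2)%:~R.

Definition theta (d0 : nat) : Rpm -> mring (mulmonoid 'Z_(2 * d0)) :=
  mring_map (@theta_mon d0).

(* theta_d is multiplicative only for d0 even; 'Z_(2 * d0) is Z/(2 d0) as soon
   as d0 > 0. *)
Lemma theta_mon_morphism (d0 : nat) : (0 < d0)%N -> ~~ odd d0 ->
  monoid.monoid_morphism (@theta_mon d0).
Proof.
move=> d0_gt0 d0_even; split=> //.
have d_gt1 : (1 < 2 * d0)%N 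
  by case: d0 d0_gt0 d0_even => // n _ _; rewrite mulnS.
have d0d0 : d0%:R + d0%:R = 0 :> 'Z_(2 * d0).
  by rewrite -natrD addnn -mul2n pchar_Zp.
have d0n (n : nat) : odd n -> d0%:R * n%:R = d0%:R :> 'Z_(2 * d0).
  move=> n_odd; rewrite -(odd_double_half n) n_odd natrD mulrDr mulr1.
  by rewrite -addnn natrD mulrDr -mulrDl d0d0 mul0r addr0.
have d0M (m : zodd) : d0%:R * (val m)%:~R = d0%:R :> 'Z_(2 * d0).
  case: m => [[n|n] /= n_odd]; first exact: d0n.
  by rewrite NegzE mulrNz mulrN d0n //; apply/eqP; rewrite eq_sym -addr_eq0 d0d0.
have d0sq : d0%:R * d0%:R = 0 :> 'Z_(2 * d0).
  rewrite -natrM (_ : d0 * d0 = d0./2 * (2 * d0))%N.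
    by rewrite natrM pchar_Zp ?mulr0.
  by rewrite mulnA muln2 even_halfK.
move=> [[e /= e1] m] [[e' /= e1'] m']; rewrite /theta_mon /= intrM.
case/orP: e1 => /eqP->; case/orP: e1' => /eqP-> //=; rewrite ?mulr1.
- by rewrite [RHS]mulrDr [_ * d0%:R]mulrC d0M.
- by rewrite [RHS]mulrDl d0M.
rewrite [RHS]mulrDl !mulrDr d0sq d0M add0r [_ * d0%:R]mulrC d0M addrA d0d0.
by rewrite add0r.
Qed.

Lemma theta_monoid_morphism (d0 : nat) : (0 < d0)%N -> ~~ odd d0 ->
  GRing.monoid_morphism (theta d0).
Proof.
by move=> *; apply: mring_map_monoid_morphism; apply: theta_mon_morphism.
Qed.

(* xi is a pole of F when it is a zero of the denominator of F in lowest
   terms. *)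
Definition pole (C : numFieldType) (F : Qx) (xi : C) : Prop :=
  exists P Q : {poly rat},
    [/\ Q != 0, coprimep P Q, F = P%:F / Q%:F
      & root (map_poly ratr Q) xi].

Definition defined_at (C : numFieldType) (F : Qx) (xi : C) : Prop :=
  ~ pole F xi.

Definition PhiQ (d : nat) : {poly rat} := map_poly intr 'Phi_d.

Definition Phi_factor (d : nat) (F : Qx) : Prop :=
  exists P Q : {poly rat},
    [/\ F = P%:F / Q%:F, PhiQ d %| P & ~~ (PhiQ d %| Q)].

(* Main.v *)
(* Every (e, m) satisfies spow zeta (e, m) = zeta ^+ theta_mon (e, m), because
   zeta ^+ d0 = -1. Hence the value at zeta of alpha f, which is the sum of the
   a_(e,m) f(zeta^(e,m)), depends on alpha only through theta_d alpha; it
   therefore equals the value at zeta of beta f = 0. As Phi_d is the minimal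
   polynomial of zeta over Q, it divides the numerator of alpha f. *)
Require Import Defs.
From mathcomp Require Import all_boot all_order all_algebra all_field.
From mathcomp Require Import finmap monalg complex reals.

Set Implicit Arguments.
Unset Strict Implicit.
Unset Printing Implicit Defensive.

Import GRing.Theory Num.Theory.

Local Open Scope fset_scope.
Local Open Scope ring_scope.

Lemma frac_coprime (f : Qx) : exists P Q : {poly rat},
  [/\ Q != 0, coprimep P Q & f = P%:F / Q%:F].
Proof.
have nzd : \d_(repr f) != 0 by apply: denom_ratioP.
have fE : f = (\n_(repr f))%:F / (\d_(repr f))%:F.
  rewrite -[LHS]reprK; apply: (mulIf (x := (\d_(repr f))%:F)).
    by rewrite tofrac_eq0.
  rewrite divfK ?tofrac_eq0 //; move: (repr f) nzd => r nzd.
  unlock FracField.tofrac; rewrite -[LHS]FracField.pi_mul; apply/eqmodP.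
  rewrite /= FracField.equivfE /FracField.mulf.
  by rewrite !numden_Ratio ?mulr1 ?oner_neq0 // mulrC.
move: (\n_(repr f)) (\d_(repr f)) nzd fE => A B nzB ->.
pose G := gcdp A B.
exists (A %/ G), (B %/ G); split.
- by rewrite dvdp_div_eq0 ?dvdp_gcdr.
- by apply: coprimep_div_gcd; rewrite nzB orbT.
apply/eqP; rewrite eqr_div ?tofrac_eq0 ?dvdp_div_eq0 ?dvdp_gcdr //.
rewrite -!tofracM tofrac_eq.
have AE : A %/ G * G = A by rewrite divpK ?dvdp_gcdl.
have BE : B %/ G * G = B by rewrite divpK ?dvdp_gcdr.
by rewrite -{1}AE -{2}BE -mulrA [G * _]mulrC.
Qed.

Section CyclotomicOverQ.

Lemma PhiQ_coprimep (d : nat) (P : {poly rat}) :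
  (0 < d)%N -> ~~ (PhiQ d %| P) -> coprimep (PhiQ d) P.
Proof.
move=> d_gt0 ndvdP; have [z zP] := C_prim_root_exists d_gt0.
have [p [pE p_monic] pP] := minCpolyP z.
have PhiE : PhiQ d = p.
  apply: (map_poly_inj (ratr : {rmorphism rat -> algC})).
  rewrite -pE (minCpoly_cyclotomic zP) -(Cintr_Cyclotomic zP) /PhiQ.
  by rewrite -map_poly_comp; apply: eq_map_poly => x /=; rewrite ratr_int.
rewrite PhiE in ndvdP *.
have := divpK (dvdp_gcdl p P); set D := gcdp p P; set E := p %/ D => DE.
have : root (map_poly ratr p) z by rewrite pP.
rewrite -{1}DE rmorphM rootM !pP => /orP[|pD]; last first.
  by case/negP: ndvdP; apply: dvdp_trans pD (dvdp_gcdr _ _).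
have nzp : p != 0 by rewrite monic_neq0.
have nzE : E != 0 by apply: contraNneq nzp => E0; rewrite -DE E0 mul0r.
have nzD : D != 0 by apply: contraNneq nzp => D0; rewrite -DE D0 mulr0.
move/(dvdp_leq nzE); rewrite -{1}DE size_mul //.
rewrite /coprimep -/D -[X in (_ <= X)%N]add0n -subn1 -addnBA ?size_poly_gt0 //.
rewrite addnC leq_add2r leqn0 subn_eq0 => D1.
by rewrite eqn_leq D1 size_poly_gt0.
Qed.

Variables (C : numFieldType) (d : nat) (zeta : C).
Hypothesis zetaP : d.-primitive_root zeta.

Lemma PhiQ_root : root (map_poly ratr (PhiQ d)) zeta.
Proof.
have d_gt0 := prim_order_gt0 zetaP.
have intE (p : {poly int}) :
    map_poly (ratr : rat -> C) (map_poly intr p) = map_poly intr p.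
  by rewrite -map_poly_comp; apply: eq_map_poly => x /=; rewrite ratr_int.
rewrite /PhiQ intE.
have Xn1 n : (0 < n)%N -> \prod_(e <- divisors n) map_poly intr 'Phi_e
    = 'X^n - 1 :> {poly C}.
  move=> n_gt0; rewrite -rmorph_prod /= prod_Cyclotomic //.
  by rewrite rmorphB rmorph1 /= map_polyXn.
have : root ('X^d - 1 : {poly C}) zeta.
  by rewrite rootE !hornerE (prim_expr_order zetaP) subrr.
rewrite -(Xn1 d d_gt0) rootE horner_prod prodf_seq_eq0 => /hasP[e].
rewrite -dvdn_divisors // => e_d root_e.
have e_gt0 := dvdn_gt0 d_gt0 e_d.
suff d_e : (d %| e)%N.
  by rewrite (_ : d = e) //; apply/eqP; rewrite eqn_dvd d_e.
rewrite (prim_order_dvd zetaP) -subr_eq0.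
have : root ('X^e - 1 : {poly C}) zeta.
  rewrite -(Xn1 e e_gt0) rootE horner_prod prodf_seq_eq0; apply/hasP.
  by exists e; rewrite // -dvdn_divisors.
by rewrite rootE !hornerE.
Qed.

Lemma PhiQ_dvdE (P : {poly rat}) :
  (PhiQ d %| P) = root (map_poly ratr P) zeta.
Proof.
apply/idP/idP => [dvdP | rootP].
  by apply: root_dvdp PhiQ_root; rewrite dvdp_map.
apply: contraTT rootP => /(PhiQ_coprimep (prim_order_gt0 zetaP)).
rewrite -(coprimep_map (ratr : {rmorphism rat -> C})).
by move/coprimep_root; apply; apply: PhiQ_root.
Qed.

End CyclotomicOverQ.

Section Specialization.
Variables (C : numFieldType) (z : C).

Local Notation evC P x := (map_poly ratr P).[x].

Definition specializes (F : Qx) (v : C) : Prop :=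
  exists P Q : {poly rat},
    [/\ evC Q z != 0, F = P%:F / Q%:F & v = evC P z / evC Q z].

Lemma evC_neq0 (Q : {poly rat}) (x : C) : evC Q x != 0 -> Q != 0.
Proof. by apply: contraNneq => ->; rewrite rmorph0 horner0. Qed.

Lemma defined_at_denom (P Q : {poly rat}) (x : C) :
  Q != 0 -> coprimep P Q -> defined_at (P%:F / Q%:F) x -> evC Q x != 0.
Proof. by move=> nzQ coPQ Px; apply/negP => Qx; apply: Px; exists P, Q. Qed.

Lemma specializes_poly P : specializes P%:F (evC P z).
Proof.
by exists P, 1; rewrite !rmorph1 hornerC !divr1 oner_neq0.
Qed.

Lemma specializesD F G u v :
  specializes F u -> specializes G v -> specializes (F + G) (u + v).
Proof.
move=> [P [Q [nzQ -> ->]]] [P' [Q' [nzQ' -> ->]]].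
exists (P * Q' + P' * Q), (Q * Q'); split.
- by rewrite rmorphM hornerM mulf_neq0.
- rewrite addf_div ?tofrac_eq0 ?(evC_neq0 (x := z)) //.
  by rewrite tofracD !tofracM.
- by rewrite addf_div // rmorphD !rmorphM /= hornerD !hornerM.
Qed.

Lemma specializesM F G u v :
  specializes F u -> specializes G v -> specializes (F * G) (u * v).
Proof.
move=> [P [Q [nzQ -> ->]]] [P' [Q' [nzQ' -> ->]]].
exists (P * P'), (Q * Q'); split.
- by rewrite rmorphM hornerM mulf_neq0.
- by rewrite mulf_div !tofracM.
- by rewrite mulf_div !rmorphM /= !hornerM.
Qed.

Lemma specializesV F u : u != 0 -> specializes F u -> specializes F^-1 u^-1.
Proof.
move=> nzu [P [Q [nzQ -> uE]]]; exists Q, P; rewrite uE !invf_div; split=> //.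
by apply: contraNneq nzu => P0; rewrite uE P0 mul0r.
Qed.

Lemma specializes_int (n : int) : specializes n%:~R n%:~R.
Proof.
by have := specializes_poly n%:~R; rewrite !rmorph_int horner_int.
Qed.

Lemma specializesXn F u n : specializes F u -> specializes (F ^+ n) (u ^+ n).
Proof.
move=> Fu; elim: n => [|n IHn]; first exact: (specializes_int 1).
by rewrite !exprS; apply: specializesM.
Qed.

Lemma specializes_spow F u k :
  u != 0 -> specializes F u -> specializes (spow F k) (spow u k).
Proof.
move=> nzu Fu; apply: specializesM; first exact: specializes_int.
case: (val k.2) => n; first exact: specializesXn.
by apply: specializesV; [apply: expf_neq0 | apply: specializesXn].
Qed.

Lemma specializes_peval P F u :
  specializes F u -> specializes (peval P F) (evC P u).
Proof.
move=> Fu; elim/poly_ind: P => [|P c IHP].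
  by rewrite /peval !rmorph0 !horner0; apply: (specializes_int 0).
rewrite /peval !rmorphD !rmorphM /= !map_polyX !map_polyC.
rewrite !hornerD !hornerM !hornerX !hornerC.
apply: specializesD; first exact: specializesM.
by have := specializes_poly c%:P; rewrite map_polyC hornerC.
Qed.

Lemma specializes_sum (I : eqType) (s : seq I) (F : I -> Qx) (v : I -> C) :
  (forall i, i \in s -> specializes (F i) (v i)) ->
  specializes (\sum_(i <- s) F i) (\sum_(i <- s) v i).
Proof.
elim: s => [|i s IHs] Fv; first by rewrite !big_nil; apply: (specializes_int 0).
rewrite !big_cons; apply: specializesD; first by apply: Fv; rewrite mem_head.
by apply: IHs => j sj; apply: Fv; rewrite inE sj orbT.
Qed.

Lemma specializes0 v : specializes 0 v -> v = 0.
Proof.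
move=> [P [Q [nzQ /esym/eqP + ->]]].
rewrite mulf_eq0 invr_eq0 !tofrac_eq0 (negPf (evC_neq0 nzQ)) orbF => /eqP->.
by rewrite rmorph0 horner0 mul0r.
Qed.

Lemma specializes_sact (P Q : {poly rat}) (r : Rpm) :
    z != 0 -> (forall k, k \in msupp r -> evC Q (spow z k) != 0) ->
  specializes (sact r (P%:F / Q%:F))
    (mmap intr (fun k => evC P (spow z k) / evC Q (spow z k)) r).
Proof.
move=> nzz nzQ; rewrite /sact !mmapE; apply: specializes_sum => k kr.
apply: specializesM; first exact: specializes_int.
rewrite sact1_frac ?(evC_neq0 (nzQ k kr)) //.
have Xk : specializes (spow 'X%:F k) (spow z k).
  apply: specializes_spow => //.
  by have := specializes_poly 'X; rewrite map_polyX hornerX.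
apply: specializesM; first exact: specializes_peval.
by apply: specializesV; [apply: nzQ | apply: specializes_peval].
Qed.

End Specialization.

Lemma mmap_mring_map (M N : monoidType) (S : nzRingType) (h : M -> N)
    (v : N -> S) (g : mring M) :
  mmap intr v (mring_map h g) = mmap intr (v \o h) g.
Proof.
rewrite /mring_map [mmap _ _ g in LHS]mmapE raddf_sum [RHS]mmapE.
apply: eq_bigr => k _; by rewrite mulrzl raddfMz /= mmapU mul1r mulrzl.
Qed.

Section PowersOfRootOfUnity.
Variables (C : fieldType) (d : nat) (z : C).
Hypotheses (d_gt1 : (1 < d)%N) (zP : d.-primitive_root z).

Lemma exprZpD (x y : 'Z_d) : z ^+ (x + y)%R = z ^+ x * z ^+ y.
Proof.
rewrite -exprD -(prim_expr_mod zP (_ + _)%N) /=.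
by congr (z ^+ (_ %% _)%N); apply: Zp_cast.
Qed.

Lemma exprZp_nat (n : nat) : z ^+ (n%:R : 'Z_d) = z ^+ n.
Proof. by rewrite val_Zp_nat // (prim_expr_mod zP). Qed.

Lemma exprZp_int (m : int) : z ^+ (m%:~R : 'Z_d) = z ^ m.
Proof.
case: m => n; first exact: exprZp_nat.
rewrite NegzE mulrNz -exprnN -(exprZp_nat n.+1).
set x : 'Z_d := n.+1%:R.
have nz : z ^+ x != 0.
  by rewrite expf_neq0 // (prim_root_eq0 zP) -lt0n (prim_order_gt0 zP).
apply: (mulfI nz). by rewrite mulfV // -exprZpD subrr.
Qed.

End PowersOfRootOfUnity.

Lemma prim_root_half (C : fieldType) (d0 : nat) (z : C) :
  (0 < d0)%N -> (2 * d0).-primitive_root z -> z ^+ d0 = -1.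
Proof.
move=> d0_gt0 zP.
have : (z ^+ d0) ^+ 2 == 1 by rewrite -exprM mulnC (prim_expr_order zP).
rewrite sqrf_eq1 => /orP[|/eqP//]; rewrite -(prim_order_dvd zP).
by move/(dvdn_leq d0_gt0); rewrite leqNgt ltn_Pmull.
Qed.

Lemma spow_theta_mon (C : fieldType) (d0 : nat) (z : C) (k : signed_odd) :
    (0 < d0)%N -> (2 * d0).-primitive_root z ->
  spow z k = z ^+ (theta_mon d0 k : 'Z_(2 * d0)).
Proof.
move=> d0_gt0 zP.
have d_gt1 : (1 < 2 * d0)%N by rewrite leq_pmulr.
rewrite /spow /theta_mon; case: k => -[e /= /orP[]/eqP->] m /=.
  by rewrite mul1r exprZp_int.
rewrite (exprZpD d_gt1 zP) exprZp_int // exprZp_nat //.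
by rewrite (prim_root_half d0_gt0 zP) rmorphN1.
Qed.

Lemma Phi_factor_sact (C : numFieldType) (d d0 : nat) (zeta : C)
    (f : Qx) (alpha : Rpm) :
  (0 < d0)%N -> ~~ odd d0 -> d = (2 * d0)%N -> d.-primitive_root zeta ->
  (exists beta : Rpm,
    [/\ beta \in Ann f,
        theta d0 alpha = theta d0 beta
      & forall k : signed_odd, k \in msupp alpha `|` msupp beta ->
          defined_at f (spow zeta k)]) ->
  Phi_factor d (sact alpha f).
Proof.
move=> d0_gt0 _ -> zetaP [beta [/eqP beta_f theta_ab f_def]].
have nz_zeta : zeta != 0.
  by rewrite (prim_root_eq0 zetaP) -lt0n muln_gt0.
have [P [Q [nzQ coPQ fE]]] := frac_coprime f.
have Q_neq0 k : k \in msupp alpha `|` msupp beta ->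
    (map_poly ratr Q).[spow zeta k] != 0.
  by move/f_def; rewrite fE; apply: defined_at_denom.
pose v (c : mulmonoid 'Z_(2 * d0)) : C :=
  (map_poly ratr P).[zeta ^+ (c : 'Z_(2 * d0))]
  / (map_poly ratr Q).[zeta ^+ (c : 'Z_(2 * d0))].
have spec (r : Rpm) : {subset msupp r <= msupp alpha `|` msupp beta} ->
    specializes zeta (sact r f) (mmap intr v (theta d0 r)).
  move=> r_sub; rewrite mmap_mring_map fE.
  have := specializes_sact P nz_zeta
    (fun k kr => Q_neq0 k (r_sub k kr)).
  congr specializes; rewrite !mmapE; apply: eq_bigr => k _.
  by rewrite /v /= (spow_theta_mon k d0_gt0 zetaP).
have beta0 : mmap intr v (theta d0 beta) = 0.
  apply: (@specializes0 _ zeta); rewrite -beta_f; apply: spec => k kb.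
  by rewrite inE kb orbT.
have [|A [B [nzB alpha_f AB0]]] := spec alpha.
  by move=> k ka; rewrite inE ka.
exists A, B; rewrite !(PhiQ_dvdE zetaP); split; [exact: alpha_f | | exact: nzB].
move/eqP: AB0; rewrite theta_ab beta0 eq_sym mulf_eq0 invr_eq0.
by rewrite (negPf nzB) orbF.
Qed.

Theorem theorem3p6 (R : realType) (d d0 : nat) (zeta : R[i])
    (f : Qx) (alpha : Rpm) :
  (0 < d0)%N -> ~~ odd d0 -> d = (2 * d0)%N -> d.-primitive_root zeta ->
  (exists beta : Rpm,
    [/\ beta \in Ann f,
        theta d0 alpha = theta d0 beta
      & forall k : signed_odd, k \in msupp alpha `|` msupp beta ->
          defined_at f (spow zeta k)]) ->
  Phi_factor d (sact alpha f).
Proof. exact: Phi_factor_sact. Qed.
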